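(* Fix $T$ with $1<T<\tfrac43$ and a constant $p\in(0,1)$. Consider the PD process on the $n\times n$ toroidal grid where the initial configuration $C_0$ makes each vertex a cooperator independently with probability $p$. Then asymptotically almost surely (as $n\to\infty$) $r_t>p^{13}$ for all $t\ge 0$, where $r_t$ is the density of cooperators in $C_t$.
   Context: A configuration on a graph $G=(V,E)$ is a map $C:V\to\{0,1\}$; $1$ means cooperator, $0$ means defector. The pay-off $f(a,b)$ to a player with strategy $a$ against strategy $b$ is $f(0,0)=0$, $f(0,1)=T$, $f(1,0)=0$, $f(1,1)=1$. The score of $v$ is $s(v)=\sum_{x\in N(v)} f(C(v),C(x))$. The most successful neighbours of $v$ are the vertices of $N[v]$ of maximum score (defectors taken as most successful in case of a tie between a cooperator and a defector). A vertex is weak if its strategy differs from that of its most successful neighbours; updating a vertex changes its strategy if it is currently weak and does nothing otherwise. PD process: given $C_t$, let $W_t$ be the set of weak vertices; if $W_t=\emptyset$ the process stops ($C_t$ is stable). Otherwise a uniformly random ordering of $W_t$ is chosen and the vertices are updated one at a time in that order, each with respect to the current configuration, producing $C_{t+1}$. The $n\times n$ toroidal grid is the Cartesian product of two $n$-cycles. Asymptotically almost surely means with probability tending to $1$ as $n\to\infty$. *)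

(* Defs.v *)
From HB Require Import structures.
From mathcomp Require Import all_boot all_order all_algebra.
From mathcomp Require Import all_classical all_reals all_analysis.

Set Implicit Arguments.
Unset Strict Implicit.
Unset Printing Implicit Defensive.

Import Order.TTheory GRing.Theory Num.Theory.
Import numFieldNormedType.Exports.

Local Open Scope classical_set_scope.
Local Open Scope ring_scope.

(* [true] is a cooperator (strategy 1), [false] a defector (strategy 0). *)
Definition config (V : finType) := {ffun V -> bool}.

Section Dynamics.
Context {R : realType} {V : finType}.
Variables (adj : rel V) (T : R).
Implicit Types (c : config V) (v x y : V).

Definition payoff (a b : bool) : R :=
  match a, b with
  | false, false => 0
  | false, true => T
  | true, false => 0
  | true, true => 1
  end.

Definition score c v : R := \sum_(x | adj v x) payoff (c v) (c x).

Definition closed_nbhd v : {set V} := [set x | (x == v) || adj v x]%SET.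

Definition max_score_nbrs c v : {set V} :=
  [set x in closed_nbhd v |
    [forall y in closed_nbhd v, score c y <= score c x]]%SET.

(* Ties between a cooperator and a defector are resolved in favour of the
   defectors, so all elements of this set have the same strategy. *)
Definition most_successful_nbrs c v : {set V} :=
  [set x in max_score_nbrs c v |
    c x ==> [forall y in max_score_nbrs c v, c y]]%SET.

Definition weak c v : bool := [exists x in most_successful_nbrs c v, c x != c v].

Definition weak_set c : {set V} := [set v | weak c v]%SET.

Definition update c v : config V :=
  if weak c v then [ffun x => if x == v then ~~ c x else c x] else c.

(* Weakness is re-evaluated in the current configuration at each turn. *)
Definition update_seq c (s : seq V) : config V := foldl update c s.

Definition weak_orderings c : seq (seq V) := permutations (enum (weak_set c)).

(* The probability that one round leads from [c] to [c'].  If [c] is stable then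
   [weak_orderings c] is [:: [::]] and the round leaves [c] unchanged, so that a
   process that has stopped is continued by the constant sequence. *)
Definition pd_step c c' : R :=
  (count (fun s => update_seq c s == c') (weak_orderings c))%:R
  / (size (weak_orderings c))%:R.

(* The probability of [c] when the vertices are independently cooperators with
   probability [p]. *)
Definition bernoulli_config (p : R) c : R :=
  \prod_(v : V) (if c v then p else 1 - p).

Definition density c : R := #|[set v | c v]%SET|%:R / #|V|%:R.

(* [C] is the Markov chain with initial law [bernoulli_config p] and transition
   probabilities [pd_step]. *)
Definition is_pd_process (p : R) (d : measure_display) (Omega : measurableType d)
    (P : probability Omega R) (C : nat -> Omega -> config V) : Prop :=
  [/\ forall (t : nat) (c : config V), measurable [set w | C t w = c],
      forall c : config V,
        P [set w | C 0%N w = c] = (bernoulli_config p c)%:E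
    & forall (t : nat) (c : nat -> config V),
        P [set w | forall s : nat, (s <= t.+1)%N -> C s w = c s] =
        (P [set w | forall s : nat, (s <= t)%N -> C s w = c s]
         * (pd_step (c t) (c t.+1))%:E)%E].

End Dynamics.

Definition cycle_adj (n : nat) : rel 'I_n :=
  [rel i j | (i != j) && ((j == ordS i) || (i == ordS j))].

Definition cartesian_adj (U V : finType) (e : rel U) (f : rel V) : rel (U * V) :=
  [rel x y | (x.1 == y.1) && f x.2 y.2 || e x.1 y.1 && (x.2 == y.2)].

Definition torus (n : nat) : finType := ('I_n * 'I_n)%type.

Definition torus_adj (n : nat) : rel (torus n) :=
  cartesian_adj (@cycle_adj n) (@cycle_adj n).

(* Main.v *)
Require Import Defs.
From HB Require Import structures.
From mathcomp Require Import all_boot all_order all_algebra.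
From mathcomp Require Import all_classical all_reals all_analysis.
From mathcomp Require Import ring lra zify.
Import Order.TTheory GRing.Theory Num.Theory.
Import numFieldNormedType.Exports.
Local Open Scope classical_set_scope.
Local Open Scope ring_scope.

Set Implicit Arguments.
Unset Strict Implicit.
Unset Printing Implicit Defensive.

(** A cooperator all of whose neighbours cooperate scores 4, and since [3 T < 4]
    only a defector with four cooperating neighbours (an isolated defector) can
    beat it.  Since [3 < 3 T], no single update creates an isolated defector.
    Hence, if a vertex and its neighbours cooperate and there is no isolated
    defector within distance 2, this remains so forever.

    In the initial configuration this happens at a given vertex as soon as its
    ball of radius 2 consists of 13 cooperators, or of 12 cooperators and one
    extremal defector [x] whose outer neighbour is a defector too.  This event
    has probability [p^13 + p^12 (1-p)^2], and the events of vertices with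
    disjoint windows are independent, so Chebyshev's inequality shows that a.a.s.
    the density of such vertices exceeds [p^13].  Almost surely each step of the
    process has positive transition probability, that is, it comes from a
    sequence of single updates. *)

(** * Invariance under single updates on a 4-regular graph *)

Lemma ltr_mul_of_le3 (R : realType) (T a b : R) :
  1 < T -> a <= 3 -> 3 <= b -> a < T * b.
Proof. by move=> T1 a3 b3; nra. Qed.

Lemma mul_lt4_of_le3 (R : realType) (T a : R) :
  1 < T -> T < 4 / 3 -> a <= 3 -> T * a < 4.
Proof. by move=> T1 T2 a3; nra. Qed.

Section FourRegular.
Context {R : realType} {V : finType}.
Variables (adj : rel V) (T : R).
Hypotheses (hT1 : 1 < T) (hT2 : T < 4 / 3).
Hypothesis adj_sym : symmetric adj.
Hypothesis deg4 : forall v, #|[set x | adj v x]%SET| = 4%N.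
Implicit Types (c : config V) (v x y z : V).

Definition coop_degree c v : nat := #|[set x | adj v x && c x]%SET|.

Definition isolated_defector c z : bool :=
  ~~ c z && [forall x, adj z x ==> c x].

(** A neighbour [u] of [v] compares [v] with its own neighbours [z]; these are the possible rivals
    of [v], which is why two steps are inspected. *)
Definition protected c v : Prop :=
  [/\ c v, forall u, adj v u -> c u &
      forall u z, adj v u -> adj u z -> ~~ isolated_defector c z].

Lemma scoreE c v :
  score adj T c v = (if c v then 1 else T) * (coop_degree c v)%:R.
Proof.
rewrite /score /coop_degree cardsE -sum1_card natr_sum mulr_sumr.
rewrite big_mkcond [RHS]big_mkcond; apply: eq_bigr => x _ /=.
rewrite unfold_in /=.
by case: (adj v x) => //=; case: (c v); case: (c x); rewrite /= ?mulr1.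
Qed.

Lemma coop_degree_lt4 c v y : adj v y -> ~~ c y -> (coop_degree c v < 4)%N.
Proof.
move=> vy cy; rewrite -(deg4 v); apply: proper_card.
apply/fintype.properP; split.
  by apply/fintype.subsetP => x; rewrite !inE => /andP[].
by exists y; rewrite !inE ?vy // (negbTE cy).
Qed.

Lemma coop_degree4 c v : (forall x, adj v x -> c x) -> coop_degree c v = 4%N.
Proof.
move=> h; rewrite -(deg4 v); apply: eq_card => x; rewrite !inE.
by case: (boolP (adj v x)) => //= /h ->.
Qed.

Lemma coop_degree_ge3 c v y :
  (forall x, x != y -> adj v x -> c x) -> (3 <= coop_degree c v)%N.
Proof.
move=> h; rewrite -ltnS -(deg4 v) (cardsD1 y [set x | adj v x]%SET).
rewrite -[_.+1]add1n leq_add ?leq_b1 //.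
apply/subset_leq_card/fintype.subsetP => x; rewrite !inE => /andP[xy vx].
by rewrite vx h.
Qed.

Lemma weak_witness c y : weak adj T c y ->
  exists x, [/\ adj y x, c x != c y &
    forall z, (z == y) || adj y z -> score adj T c z <= score adj T c x].
Proof.
case/existsP => x /andP[]; rewrite !inE => /andP[/andP[xy /forallP mx] _] cxy.
exists x; split => //.
  by case/orP: xy cxy => // /eqP ->; rewrite eqxx.
by move=> z zy; have := mx z; rewrite !inE zy.
Qed.

Lemma updateE c y x :
  update adj T c y x = (if weak adj T c y && (x == y) then ~~ c x else c x).
Proof. by rewrite /update; case: ifP => // _; rewrite ffunE. Qed.

(* A defector with three cooperating neighbours scores [3 T > 3], which beats
   every cooperator adjacent to a defector; so its last neighbour never turns
   into a cooperator. *)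
Lemma isolated_defector_update c y z :
  isolated_defector (update adj T c y) z -> isolated_defector c z.
Proof.
case: (boolP (weak adj T c y)) => wy; last by rewrite /update (negbTE wy).
have [x0 [yx0 cx0 mx]] := weak_witness wy.
case/andP=> cz /forallP hz.
have x0y : x0 != y by apply: contraNneq cx0 => ->.
have hx x : adj z x -> x != y -> c x.
  by move=> zx xy; have := hz x; rewrite zx updateE (negbTE xy) andbF.
(* Had [z] itself just turned defector, it would have imitated a defecting neighbour [x0], but its
   neighbours all cooperate. *)
have zy : z != y.
  apply: contraTneq cz => zy; subst z; rewrite updateE wy eqxx negbK.
  by move: cx0; rewrite (hx x0) //; case: (c y).
move: cz; rewrite updateE (negbTE zy) andbF => cz.
rewrite /isolated_defector cz; apply/forallP => x; apply/implyP => zx.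
have [xy|] := eqVneq x y; last exact: hx.
subst x; apply: contraT => cy.
have cx : c x0 by move: cx0; rewrite (negbTE cy); case: (c x0).
have := mx z; rewrite adj_sym zx orbT => /(_ isT).
rewrite !scoreE cx (negbTE cz) mul1r.
rewrite leNgt => /negP[]; apply: ltr_mul_of_le3 => //.
  by rewrite ler_nat -ltnS (@coop_degree_lt4 _ _ y) // adj_sym.
by rewrite ler_nat; apply: (@coop_degree_ge3 _ _ y) => // w wy' zw; apply: hx.
Qed.

Lemma protected_update c y v :
  protected c v -> protected (update adj T c y) v.
Proof.
move=> [cv cu iso].
suff keep x : (x == v) || adj v x -> update adj T c y x.
  split=> [|u vu|u z vu uz]; rewrite ?keep ?eqxx ?vu ?orbT //.
  by apply: contra (iso _ _ vu uz) => /isolated_defector_update.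
move=> xv; have cx : c x by case/orP: xv => [/eqP ->|/cu].
rewrite updateE; case: ifP => // /andP[wy /eqP xy]; subst x.
have [x0 [yx0 cx0 mx]] := weak_witness wy.
have {}cx0 : ~~ c x0 by move: cx0; rewrite cx; case: (c x0).
(* The vertex [v] has no defecting neighbour to imitate, so the changed vertex is a neighbour of
   [v]. *)
have yv : adj v y.
  by case/orP: xv => // /eqP yv; move: cx0; rewrite cu // -yv.
(* [y] sees [v] with score 4, whereas the defector [x0] is not isolated and scores at most [3 T]. *)
have := mx v; rewrite adj_sym yv orbT => /(_ isT).
rewrite !scoreE cv (negbTE cx0) mul1r (@coop_degree4 c v cu).
rewrite leNgt => /negP[]; apply: mul_lt4_of_le3 => //; rewrite ler_nat -ltnS.
have := iso _ _ yv yx0; rewrite /isolated_defector cx0 /= negb_forall.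
case/existsP => w; rewrite negb_imply => /andP[x0w cw].
exact: (@coop_degree_lt4 _ _ w).
Qed.

Lemma protected_step c c' v :
  pd_step adj T c c' != 0 -> protected c v -> protected c' v.
Proof.
rewrite /pd_step; case: (boolP (has (fun s => update_seq adj T c s == c')
  (weak_orderings adj T c))) => [/hasP[s _ /eqP <-] _|].
  elim: s c => //= y s ih c h; exact/ih/protected_update.
by rewrite has_count -eqn0Ngt => /eqP ->; rewrite mul0r eqxx.
Qed.

End FourRegular.

(** * The torus *)

Section Torus.
Variable m : nat.
Let n := m.+3.
Implicit Types (i j : 'I_n) (v x y : torus n).

(** Iterating the cyclic successor keeps offsets as plain natural numbers, so concrete offsets are
    compared by computation. *)
Definition translate (o : nat * nat) v : torus n :=
  (iter o.1 (@ordS n) v.1, iter o.2 (@ordS n) v.2).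

Lemma val_iter_ordS k i : iter k (@ordS n) i = ((i + k) %% n)%N :> nat.
Proof.
elim: k => [|k ih]; first by rewrite /= addn0 modn_small.
by rewrite iterS /= ih addnS -[in LHS]addn1 modnDml addn1.
Qed.

Lemma translate_inj o : injective (translate o).
Proof.
have inj k : injective (iter k (@ordS n)).
  by elim: k => // k ih i j /ordS_inj /ih.
by move=> [i j] [i' j'] [/inj -> /inj ->].
Qed.

Lemma translate_inj_offset v o o' : (o.1 < n)%N -> (o.2 < n)%N -> (o'.1 < n)%N ->
  (o'.2 < n)%N -> translate o v = translate o' v -> o = o'.
Proof.
have inj i k k' : (k < n)%N -> (k' < n)%N ->
    iter k (@ordS n) i = iter k' (@ordS n) i -> k = k'.
  move=> kn kn' /(congr1 val) /=; rewrite !val_iter_ordS => /eqP.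
  by rewrite eqn_modDl !modn_small // => /eqP.
by case: o o' => [a b] [a' b'] /= ? ? ? ? [/inj -> // /inj ->].
Qed.

Lemma torus_adj_sym : symmetric (@torus_adj n).
Proof.
have cs : symmetric (@cycle_adj n).
  by move=> i j; rewrite /cycle_adj /= eq_sym orbC.
move=> x y; rewrite /torus_adj /cartesian_adj /= cs (cs x.1).
by rewrite (eq_sym x.1) (eq_sym x.2).
Qed.

(** Seen from [ordS i], both neighbours are forward translates of [i], so adjacency is expressed by
    successors alone. *)
Lemma cycle_adj_ordS i j : cycle_adj (ordS i) j = (j == i) || (j == ordS (ordS i)).
Proof.
rewrite /cycle_adj /= (inj_eq (@ordS_inj n)) [i == j]eq_sym orbC.
have ne (k : 'I_n) : ordS k != k.
  apply/eqP => /(congr1 val) /=.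
  have := ltn_ord k; rewrite leq_eqVlt => /orP[/eqP kn|kn].
    by rewrite kn modnn => k0; move: kn; rewrite -k0.
  by rewrite modn_small //; lia.
have [->|ji] /= := eqVneq j i; first by rewrite ne.
have [->|jj] /= := eqVneq j (ordS (ordS i)); last by rewrite andbF.
by rewrite eq_sym ne.
Qed.

Lemma torus_adj_translate a b v y : torus_adj (translate (a.+1, b.+1) v) y =
  (y \in [seq translate o v | o <- [:: (a, b.+1); (a.+2, b.+1); (a.+1, b); (a.+1, b.+2)]]).
Proof.
rewrite /torus_adj /cartesian_adj /= !cycle_adj_ordS !inE /translate /=.
case: y => y1 y2 /=; rewrite !xpair_eqE.
rewrite [ordS _ == y1]eq_sym [ordS _ == y2]eq_sym.
by do ![case: (_ == _) => //=].
Qed.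

Lemma translate_surj o y : exists v, y = translate o v.
Proof. by have [g _ gK] := injF_bij (@translate_inj o); exists (g y); rewrite gK. Qed.

Lemma map_translate_uniq v (s : seq (nat * nat)) :
  all (fun o => (o.1 < n)%N && (o.2 < n)%N) s -> uniq s ->
  uniq [seq translate o v | o <- s].
Proof.
move=> /allP sn us; rewrite map_inj_in_uniq // => o o'.
by move=> /sn /andP[? ?] /sn /andP[? ?]; apply: translate_inj_offset.
Qed.

Lemma torus_deg4 y : #|[set x | torus_adj y x]%SET| = 4%N.
Proof.
(* With [y] at offset [(1, 1)], its four neighbours have distinct offsets with coordinates below 3,
   hence below [n]. *)
have [v ->] := translate_surj (1, 1)%N y.
rewrite (eq_card (B := mem [seq translate o v | o <-
  [:: (0, 1); (2, 1); (1, 0); (1, 2)]%N])) => [|x].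
  by rewrite (card_uniqP _) // map_translate_uniq.
by rewrite inE torus_adj_translate.
Qed.

End Torus.

(** * Product Bernoulli measure *)

Section BernoulliMean.
Context {R : realType} {V : finType}.
Variable p : R.
Hypotheses (p0 : 0 <= p) (p1 : p <= 1).
Implicit Types (f g : config V -> R) (c : config V).

Definition mean f : R := \sum_c bernoulli_config p c * f c.

Lemma bernoulli_config_ge0 c : 0 <= bernoulli_config p c.
Proof. by apply: prodr_ge0 => v _; case: (c v) => //; rewrite subr_ge0. Qed.

Lemma meanD f g : mean (fun c => f c + g c) = mean f + mean g.
Proof. by rewrite /mean -big_split; apply: eq_bigr => c _; rewrite mulrDr. Qed.

Lemma mean_sum (I : finType) (F : I -> config V -> R) :
  mean (fun c => \sum_i F i c) = \sum_i mean (F i).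
Proof. by rewrite /mean exchange_big; apply: eq_bigr => c _; rewrite mulr_sumr. Qed.

Lemma meanZ a f : mean (fun c => a * f c) = a * mean f.
Proof. by rewrite /mean mulr_sumr; apply: eq_bigr => c _; rewrite mulrCA. Qed.

Lemma eq_mean f g : f =1 g -> mean f = mean g.
Proof. by move=> fg; apply: eq_bigr => c _; rewrite fg. Qed.

Lemma le_mean f g : (forall c, f c <= g c) -> mean f <= mean g.
Proof.
by move=> fg; apply: ler_sum => c _; rewrite ler_wpM2l ?bernoulli_config_ge0.
Qed.

(** Expanding the product of two-term sums means choosing a value at each vertex, that is, summing
    over configurations. *)
Lemma mean_prod (h : V -> bool -> R) :
  mean (fun c => \prod_v h v (c v)) =
  \prod_v (p * h v true + (1 - p) * h v false).
Proof.
under [RHS]eq_bigr => v _ do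
  rewrite -(big_bool _ (fun b => (if b then p else 1 - p) * h v b)).
rewrite bigA_distr_bigA; apply: eq_bigr => c _.
by rewrite /bernoulli_config -big_split.
Qed.

Lemma mean_cst a : mean (fun=> a) = a.
Proof.
rewrite -[a in LHS]mulr1 (meanZ a (fun=> 1)) (_ : mean _ = 1) ?mulr1 //.
rewrite (@eq_mean _ (fun c => \prod_v (fun _ _ => 1) v (c v))).
  by rewrite (mean_prod (fun _ _ => 1)) big1 // => v _; rewrite !mulr1 addrC subrK.
by move=> c; rewrite big1.
Qed.

(** Independence of functions of disjoint sets of coordinates: at each vertex one of the two factors
    is constantly 1. *)
Lemma mean_prodM (h k : V -> bool -> R) :
  (forall v, (forall b, h v b = 1) \/ (forall b, k v b = 1)) ->
  mean (fun c => (\prod_v h v (c v)) * \prod_v k v (c v)) =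
  mean (fun c => \prod_v h v (c v)) * mean (fun c => \prod_v k v (c v)).
Proof.
move=> hk; rewrite (@eq_mean _ (fun c => \prod_v (fun v b => h v b * k v b) v (c v))).
  rewrite (mean_prod (fun v b => h v b * k v b)) !mean_prod -big_split; apply: eq_bigr => v _ /=.
  by case: (hk v) => e; rewrite !e; ring.
by move=> c; rewrite -big_split.
Qed.

(** For disjoint [A] and [B], the product of these factors is the indicator of cooperation on [A]
    and defection on [B], in the form that [mean_prod] handles. *)
Definition cylinder_factor (A B : {set V}) (v : V) (b : bool) : R :=
  if v \in A then b%:R else if v \in B then (~~ b)%:R else 1.

Definition cylinder (A B : {set V}) c : R := \prod_v cylinder_factor A B v (c v).

Lemma mean_cylinder (A B : {set V}) : [disjoint A & B]%B ->
  mean (cylinder A B) = p ^+ #|A| * (1 - p) ^+ #|B|.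
Proof.
move=> AB; rewrite mean_prod -!prodr_const.
rewrite (big_mkcond (mem A)) (big_mkcond (mem B)) -big_split /=.
apply: eq_bigr => v _; rewrite /cylinder_factor.
have [vA|vA] := boolP (v \in A).
  by rewrite (disjointFr AB vA) !mulr1 mulr0 addr0.
have [vB|vB] := boolP (v \in B); rewrite /= ?mulr0 ?mulr1 ?mul1r ?add0r //.
by rewrite addrC subrK.
Qed.

Lemma cylinderE (A B : {set V}) c : [disjoint A & B]%B -> cylinder A B c =
  ((A \subset [set v | c v]%SET) && (B \subset [set v | ~~ c v]%SET))%:R.
Proof.
move=> AB; rewrite /cylinder.
case: (boolP (_ && _)) => [/andP[/fintype.subsetP sA /fintype.subsetP sB]|].
  rewrite big1 // => v _; rewrite /cylinder_factor.
  case: ifP => [/sA|vA]; first by rewrite inE => ->.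
  by case: ifP => // /sB; rewrite inE => ->.
rewrite negb_and => /orP[|] /fintype.subsetPn[v vAB]; rewrite inE ?negbK => cv.
  by apply/eqP/prodf_eq0; exists v; rewrite // /cylinder_factor vAB (negbTE cv).
apply/eqP/prodf_eq0; exists v => //.
by rewrite /cylinder_factor (disjointFl AB vAB) vAB cv.
Qed.

Lemma mean_cylinderM (A B A' B' : {set V}) : [disjoint A :|: B & A' :|: B']%B ->
  mean (fun c => cylinder A B c * cylinder A' B' c) =
  mean (cylinder A B) * mean (cylinder A' B').
Proof.
move=> dis; apply: mean_prodM => v; rewrite /cylinder_factor.
have [vA|] := boolP (v \in A :|: B).
  right => b; have := disjointFr dis vA; rewrite inE => /negbT.
  by rewrite negb_or => /andP[/negbTE -> /negbTE ->].
by rewrite inE negb_or => /andP[/negbTE -> /negbTE ->]; left.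
Qed.

(** The variance of the sum is a sum of covariances, which vanish off [dep] and are at most 1 on it;
    so it is at most [K * #|I|]. *)
Lemma weak_dependence_chebyshev (I : finType) (f : I -> config V -> R)
    (q e : R) (dep : rel I) (K : nat) :
  (forall i c, 0 <= f i c <= 1) -> (forall i, mean (f i) = q) ->
  (forall i j, ~~ dep i j -> mean (fun c => f i c * f j c) = q ^+ 2) ->
  (forall i, (#|[pred j | dep i j]| <= K)%N) ->
  0 < e -> (0 < #|I|)%N ->
  \sum_(c | \sum_i f i c <= (q - e) * #|I|%:R) bernoulli_config p c
    <= K%:R / (e ^+ 2 * #|I|%:R).
Proof.
move=> f01 fq fdep degK e0 I0.
have N0 : 0 < #|I|%:R :> R by rewrite ltr0n.
set N : R := #|I|%:R in N0 *.
set X := fun c => \sum_i f i c.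
have var : mean (fun c => (X c - q * N) ^+ 2) <= K%:R * N.
  rewrite (@eq_mean _ (fun c => \sum_i \sum_j (f i c - q) * (f j c - q))); last first.
    move=> c; have -> : X c - q * N = \sum_i (f i c - q).
      by rewrite sumrB sumr_const -mulr_natr.
    by rewrite expr2 mulr_suml; apply: eq_bigr => i _; rewrite mulr_sumr.
  rewrite mean_sum /N -sum1_card natr_sum mulr_sumr.
  apply: ler_sum => i _; rewrite mean_sum mulr1.
  apply: (@le_trans _ _ (\sum_j (dep i j)%:R)); last first.
    rewrite -natr_sum ler_nat; apply: leq_trans (degK i).
    rewrite -sum1_card [leqRHS]big_mkcond; apply: leq_sum => j _.
    by rewrite unfold_in /=; case: (dep i j).
  apply: ler_sum => j _.
  rewrite (@eq_mean _ (fun c => f i c * f j c + (- q * f i c + (- q * f j c + q ^+ 2)))).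
    rewrite !meanD !meanZ mean_cst !fq.
    have [dij|/fdep ->] := boolP (dep i j); last first.
      by rewrite le_eqVlt; apply/orP; left; apply/eqP; rewrite /=; ring.
    have le1 : mean (fun c => f i c * f j c) <= 1.
      rewrite -[leRHS](mean_cst 1); apply: le_mean => c.
      by have /andP[? ?] := f01 i c; have /andP[? ?] := f01 j c; exact: mulr_ile1.
    have := sqr_ge0 q; rewrite /=; nra.
  by move=> c; ring.
rewrite ler_pdivlMr ?mulr_gt0 ?exprn_gt0 //.
rewrite -(ler_pM2r N0) -mulrA; apply: le_trans var.
(* Markov's inequality, term by term: where [X c] is small the squared deviation is at least
   [(e * N) ^+ 2], and elsewhere it is nonnegative. *)
rewrite mulr_suml [leLHS]big_mkcond; apply: ler_sum => c _.
case: ifP => [Xc|_]; last by rewrite mulr_ge0 ?bernoulli_config_ge0 ?sqr_ge0.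
rewrite ler_wpM2l ?bernoulli_config_ge0 //.
rewrite -mulrA -expr2 -exprMn -[leRHS]sqrrN; apply: lerXn2r; rewrite ?nnegrE.
- by rewrite mulr_ge0 // ltW.
- by move: Xc; rewrite -/(X c) -/N; nra.
- by move: Xc; rewrite -/(X c) -/N; nra.
Qed.

End BernoulliMean.

(** * Surviving cooperators *)

Section Survivors.
Variable m : nat.
Hypothesis m3 : (3 <= m)%N.
Let n := m.+3.
Implicit Types (v w x : torus n) (c : config (torus n)) (s : seq (nat * nat)).

(* Offsets are counted from a corner of the window, so that they are natural
   numbers; the centre of the window is at [(2, 2)].  This is the ball of radius
   2 about the centre without [(4, 2)]. *)
Definition core_offsets : seq (nat * nat) :=
  [:: (2, 2); (1, 2); (3, 2); (2, 1); (2, 3); (0, 2); (2, 0); (2, 4);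
      (1, 1); (1, 3); (3, 1); (3, 3)]%N.

Definition window_offsets := [:: (4, 2), (5, 2) & core_offsets]%N.

Definition points s v : {set torus n} := [set x in [seq translate o v | o <- s]]%SET.

Lemma mem_points s v x : (x \in points s v) = (x \in [seq translate o v | o <- s]).
Proof. by rewrite inE. Qed.

(* If [(4, 2)] is a defector, then the defector at [(5, 2)] keeps it from having
   four cooperating neighbours.  Allowing this case makes the probability of a
   survivor strictly larger than [p ^+ 13]. *)
Definition survivor v c : bool :=
  all (fun o => c (translate o v)) core_offsets
  && (c (translate (4, 2)%N v) || ~~ c (translate (5, 2)%N v)).

Lemma offset_lt o : o \in window_offsets -> (o.1 < n)%N && (o.2 < n)%N.
Proof.
(* The largest coordinate is 5, and [m >= 3] gives [n >= 6]. *)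
have : all (fun o => (o.1 < 6)%N && (o.2 < 6)%N) window_offsets by [].
move=> /allP + ow => /(_ _ ow) /andP[? ?].
by apply/andP; split; apply: (@leq_trans 6).
Qed.

Lemma card_points s v : {subset s <= window_offsets} -> uniq s ->
  #|points s v| = size s.
Proof.
move=> sw us; rewrite cardsE -(size_map (fun o => translate o v) s); apply/card_uniqP.
apply: map_translate_uniq => //; apply/allP => o /sw; exact: offset_lt.
Qed.

Lemma disjoint_points s t v : {subset s <= window_offsets} ->
  {subset t <= window_offsets} -> ~~ has (mem s) t ->
  [disjoint points s v & points t v]%B.
Proof.
move=> sw tw /hasPn st; rewrite -finset.setI_eq0; apply/eqP/setP => x.
rewrite finset.in_setI !mem_points finset.in_set0.
apply/negP => /andP[/mapP[ o os ->] /mapP[ o' ot]].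
have /andP[? ?] := offset_lt (sw _ os); have /andP[? ?] := offset_lt (tw _ ot).
by move=> /translate_inj_offset oo'; move: os; rewrite oo' //; apply/negP/st.
Qed.

Lemma points_sub s v (P : pred (torus n)) :
  (points s v \subset [set x | P x]%SET) = all (fun o => P (translate o v)) s.
Proof.
apply/fintype.subsetP/allP => [h o os|h x].
  by have := h (translate o v); rewrite !inE; apply; apply: (map_f (fun o => translate o v)).
by rewrite !inE => /mapP[ o os ->]; apply: h.
Qed.

(** Split on the strategy at [(4, 2)]: the two cases are exclusive, and each is a cylinder. *)
Lemma survivorE (R : realType) v c : (survivor v c)%:R =
  cylinder (points ((4, 2)%N :: core_offsets) v) finset.set0 c
  + cylinder (points core_offsets v) (points [:: (4, 2); (5, 2)]%N v) c :> R.
Proof.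
have sub s : all (mem window_offsets) s -> {subset s <= window_offsets}.
  by move/allP.
rewrite !cylinderE ?disjoint_points //; last 3 first.
- exact: sub.
- exact: sub.
- by rewrite -finset.setI_eq0 finset.setI0.
rewrite !points_sub finset.sub0set andbT /survivor.
move: core_offsets => s /=; rewrite andbT.
by case: (c _); case: (c _); case: (all _ s); rewrite /= ?addr0 ?add0r.
Qed.

Lemma survivor_protected v c :
  survivor v c -> protected (@torus_adj n) c (translate (2, 2)%N v).
Proof.
case/andP => /allP core c42.
have cc o : o \in core_offsets -> c (translate o v) by exact: core.
split=> [|u|u z].
- exact: cc.
- by rewrite torus_adj_translate /= !inE => /or4P[] /eqP ->; apply: cc.
(* Two steps from the centre stay inside the ball of 13 points. *)
suff ball o : o \in (4, 2)%N :: core_offsets ->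
    ~~ isolated_defector (@torus_adj n) c (translate o v).
  rewrite torus_adj_translate /= !inE.
  by move=> /or4P[] /eqP ->; rewrite torus_adj_translate /= !inE;
    move=> /or4P[] /eqP ->; apply: ball.
rewrite inE => /orP[/eqP ->|/cc co]; last by rewrite /isolated_defector co.
rewrite /isolated_defector; case/orP: c42 => [-> //|c52].
rewrite negb_and negbK; apply/orP; right; apply/forallPn.
exists (translate (5, 2)%N v).
by rewrite negb_imply c52 andbT torus_adj_translate /= !inE eqxx orbT.
Qed.

Definition overlap v w : bool :=
  ~~ [disjoint points window_offsets v & points window_offsets w]%B.

(** A common point of the two windows has one of 14 offsets in each, and this pair of offsets
    determines [w]. *)
Lemma card_overlap v : (#|[pred w | overlap v w]| <= 14 ^ 2)%N.
Proof.
pose s := [seq invF (@translate_inj m o') (translate o v) |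
  o <- window_offsets, o' <- window_offsets].
apply: (@leq_trans (size s)); last by rewrite size_allpairs.
apply: leq_trans (card_size s); apply/subset_leq_card/fintype.subsetP => w.
rewrite inE /overlap -finset.setI_eq0 => /finset.set0Pn[x].
rewrite finset.in_setI !mem_points => /andP[/mapP[ o os ->] /mapP[ o' os' e]].
by apply/allpairsP; exists (o, o'); rewrite /= e invF_f.
Qed.

Context {R : realType}.
Variable p : R.
Let q : R := p ^+ 13 + p ^+ 12 * (1 - p) ^+ 2.

Lemma mean_survivor v : mean p (fun c => (survivor v c)%:R) = q.
Proof.
under eq_mean do rewrite survivorE.
have sub s : all (mem window_offsets) s -> {subset s <= window_offsets}.
  by move/allP.
rewrite meanD !mean_cylinder ?card_points ?cards0 ?mulr1 //; try exact: sub.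
- by apply: disjoint_points => //; exact: sub.
- by rewrite -finset.setI_eq0 finset.setI0.
Qed.

(** Each indicator is a sum of two cylinders; the four products factor because the windows are
    disjoint, and they regroup into a square. *)
Lemma mean_survivorM v w : ~~ overlap v w ->
  mean p (fun c => (survivor v c)%:R * (survivor w c)%:R) = q ^+ 2.
Proof.
rewrite negbK => dis.
pose A1 x := points ((4, 2)%N :: core_offsets) x.
pose A2 x := points core_offsets x.
pose B2 x := points [:: (4, 2); (5, 2)]%N x.
have subW x : (A1 x :|: finset.set0 \subset points window_offsets x)
    && (A2 x :|: B2 x \subset points window_offsets x).
  have sub s : all (mem window_offsets) s ->
      points s x \subset points window_offsets x.
    move=> /allP sw; apply/fintype.subsetP => y; rewrite !mem_points.
    by move=> /mapP[ o /sw os ->]; apply: (map_f (fun o => translate o x)).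
  by rewrite !finset.subUset finset.sub0set !sub.
have [/andP[v1 v2] /andP[w1 w2]] := (subW v, subW w).
have ind (A B A' B' : {set torus n}) :
    A :|: B \subset points window_offsets v ->
    A' :|: B' \subset points window_offsets w ->
    mean p (fun c => cylinder A B c * cylinder A' B' c) =
    mean p (cylinder A B) * mean p (cylinder A' B').
  by move=> sv sw; apply/mean_cylinderM/(disjointW sv sw dis).
have ms x : mean p (cylinder (A1 x) finset.set0) +
    mean p (cylinder (A2 x) (B2 x)) = q.
  by rewrite -(mean_survivor x) -meanD; apply: eq_mean => c; rewrite survivorE.
under eq_mean do rewrite !survivorE mulrDl !mulrDr.
by rewrite !meanD !ind // -!mulrDr -mulrDl !ms.
Qed.

End Survivors.

(** * Concentration of the density of survivors *)

Section SurvivorDensity.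
Variable m : nat.
Hypothesis m3 : (3 <= m)%N.
Let n := m.+3.
Context {R : realType}.
Implicit Types (c : config (torus n)).

(** Survivors are indexed by window corners; translation by [(2, 2)] moves them bijectively to the
    centres that cooperate. *)
Lemma density_ge_survivors c c' :
  (forall v, survivor v c -> c' (translate (2, 2)%N v)) ->
  (\sum_(v : torus n) (survivor v c)%:R) / #|torus n|%:R <= density c' :> R.
Proof.
move=> h; rewrite /density ler_wpM2r ?invr_ge0 ?ler0n // -natr_sum ler_nat.
rewrite -sum1_card [leqRHS](reindex_inj (@translate_inj m (2, 2)%N)) /=.
rewrite [leqRHS]big_mkcond; apply: leq_sum => v _; rewrite inE.
by case: (boolP (survivor v c)) => [/h ->|_].
Qed.

Lemma bernoulli_few_survivors (p : R) : 0 < p -> p < 1 ->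
  \sum_(c | ~~ (p ^+ 13 * #|torus n|%:R <
                \sum_(v : torus n) (survivor v c)%:R)) bernoulli_config p c
    <= 196 / (p ^+ 12 * (1 - p) ^+ 2) ^+ 2 / n%:R ^+ 2.
Proof.
move=> p0 p1; set e := p ^+ 12 * (1 - p) ^+ 2.
have e0 : 0 < e by rewrite mulr_gt0 ?exprn_gt0 // subr_gt0.
have N2 : #|torus n| = (n ^ 2)%N by rewrite card_prod card_ord.
(* The mean is [p ^+ 13 + e], so a deviation of [e] puts the threshold exactly at [p ^+ 13]; 196 is
   [14 ^ 2]. *)
have := @weak_dependence_chebyshev R _ p (ltW p0) (ltW p1) _
  (fun v c => (survivor v c)%:R) (p ^+ 13 + e) e (@overlap m) 196.
rewrite addrK -mulrA -invfM N2 natrX => cheb.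
under eq_bigl do rewrite -leNgt.
apply: cheb => //.
- by move=> v c; case: (survivor v c); rewrite /= ?lexx ?ler01.
- by move=> v; rewrite mean_survivor.
- by move=> v w; exact: mean_survivorM.
- exact: card_overlap.
Qed.

End SurvivorDensity.

(** * Sample paths *)

Section Process.
Context {R : realType} {V : finType}.
Variables (adj : rel V) (T p : R) (d : measure_display).
Variables (Omega : measurableType d) (P : probability Omega R).
Variable C : nat -> Omega -> config V.
Hypothesis hC : is_pd_process adj T p P C.

Lemma measurable_history (t : nat) (c : nat -> config V) :
  measurable [set w | forall s : nat, (s <= t)%N -> C s w = c s].
Proof.
case: hC => mC _ _.
rewrite (_ : [set _ | _] = \bigcap_(s in [set s | (s <= t)%N]) [set w | C s w = c s]).
  by apply: bigcap_measurableType => s _; exact: mC.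
by apply/seteqP; split.
Qed.

Lemma measurable_always (Q : pred (config V)) :
  measurable [set w | forall t, Q (C t w)].
Proof.
case: hC => mC _ _.
rewrite (_ : [set _ | _] =
    \bigcap_t \bigcup_(c in [set c | Q c]) [set w | C t w = c]).
  apply: bigcapT_measurable => t; apply: fin_bigcup_measurable => //.
  exact: finite_finset.
apply/seteqP; split=> w /= h t; first by exists (C t w); rewrite //=.
by have [c Qc ->] := h t I.
Qed.

(** Pairs of a time and a finite history are countable, and each history ending in an impossible
    step has probability 0. *)
Lemma negligible_impossible_step :
  P.-negligible [set w | exists t, pd_step adj T (C t w) (C t.+1 w) = 0].
Proof.
case: hC => _ _ step.
(* The default extends a finite list to a history indexed by [nat], as the transition law
   expects. *)
pose dflt : config V := [ffun=> false].
pose F (h : nat * seq (config V)) := [set w |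
  pd_step adj T (nth dflt h.2 h.1) (nth dflt h.2 h.1.+1) = 0 /\
  forall s : nat, (s <= h.1.+1)%N -> C s w = nth dflt h.2 s].
apply: (@negligibleS _ _ _ P (\bigcup_k if unpickle k is Some h then F h else set0)).
  move=> w [t wt]; have [q nq] : exists q : seq (config V),
      forall s, (s <= t.+1)%N -> nth dflt q s = C s w.
    by exists (mkseq (C^~ w) t.+2) => s st; rewrite nth_mkseq.
  exists (pickle (t, q)) => //; rewrite pickleK /F /=.
  by split=> [|s st]; rewrite !nq.
apply: negligible_bigcup => k; case: unpickle => [[t h]|]; last exact: negligible_set0.
case: (EM (pd_step adj T (nth dflt h t) (nth dflt h t.+1) = 0)) => [e|ne].
  apply: (negligibleS (A := [set w |
    forall s : nat, (s <= t.+1)%N -> C s w = nth dflt h s])) => [w []//|].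
  by apply/negligibleP; [exact: measurable_history|apply: (etrans (step t (nth dflt h))); rewrite e mule0].
by apply: (negligibleS _ (negligible_set0 P)) => w [].
Qed.

Lemma measure_bigsetU_le (I : finType) (Q : pred I) (F : I -> set Omega) :
  (forall i, measurable (F i)) ->
  (P (\big[setU/set0]_(i | Q i) F i) <= \sum_(i | Q i) P (F i))%E.
Proof.
move=> mF; suff [] : measurable (\big[setU/set0]_(i | Q i) F i) /\
  (P (\big[setU/set0]_(i | Q i) F i) <= \sum_(i | Q i) P (F i))%E by [].
apply: (big_ind2 (fun A x => measurable A /\ (P A <= x)%E)) => //.
  by rewrite measure0.
move=> A x B y [mA Ax] [mB By]; split; first exact: measurableU.
by apply: le_trans (measureU2 P mA mB) _; exact: leeD.
Qed.

(** Outside a null set and the bad initial configurations, every sample path satisfies the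
    hypotheses of the deterministic statement. *)
Lemma pd_process_always (G Q : pred (config V)) :
  (forall c : nat -> config V, G (c 0%N) ->
    (forall t, pd_step adj T (c t) (c t.+1) != 0) -> forall t, Q (c t)) ->
  ((1 - \sum_(c | ~~ G c) bernoulli_config p c)%:E
    <= P [set w | forall t, Q (C t w)])%E.
Proof.
move=> GQ; have mQ := measurable_always Q; set E := [set w | _] in mQ *.
have [B [mB B0 sB]] := negligible_impossible_step.
case: hC => mC init _.
set S := \big[setU/set0]_(c | ~~ G c) [set w | C 0%N w = c].
have mS : measurable S by apply: bigsetU_measurable => c _.
have cover : setT `<=` E `|` (B `|` S).
  move=> w _; case: (EM (E w)) => [|nE]; first by left.
  right; case: (EM (B w)) => [|nB]; first by left.
  right; rewrite /S -bigcup_pred; exists (C 0%N w) => //=.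
  apply/negP => Gw; apply: nE => t; apply: (GQ (C^~ w)) => // s.
  by apply/eqP => e; apply/nB/sB; exists s.
rewrite EFinB leeBlDr // -(probability_setT P).
apply: (@le_trans _ _ (P (E `|` (B `|` S)))).
  by apply: le_measure; rewrite ?inE //; do ?apply: measurableU.
apply: (le_trans (measureU2 P mQ (measurableU _ _ mB mS))).
rewrite leeD2l //; apply: (le_trans (measureU2 P mB mS)).
rewrite -[leRHS]add0e; apply: leeD.
  by rewrite le_eqVlt; apply/orP; left; apply/eqP; exact: B0.
apply: le_trans (measure_bigsetU_le _ _) _ => //.
by rewrite -sumEFin; apply: lee_sum => c _; rewrite init.
Qed.

End Process.

Theorem theorem4p7 (R : realType) (T p : R)
    (hT1 : 1 < T) (hT2 : T < 4 / 3) (hp0 : 0 < p) (hp1 : p < 1)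
    (d : nat -> measure_display)
    (Omega : forall n : nat, measurableType (d n))
    (P : forall n : nat, probability (Omega n) R)
    (C : forall n : nat, nat -> Omega n -> config (torus n))
    (hC : forall n : nat, (2 < n)%N ->
      is_pd_process (@torus_adj n) T p (P n) (C n)) :
  P n [set w | forall t : nat, p ^+ 13 < density (C n t w)] @[n --> \oo]
    --> 1%E.
Proof.
pose K : R := 196 / (p ^+ 12 * (1 - p) ^+ 2) ^+ 2.
have K0 : 0 <= K by rewrite divr_ge0 ?ler0n ?sqr_ge0.
apply: (@squeeze_cvge _ _ _ _ (fun n : nat => (1 - K * harmonic n)%:E) _
    (fun=> 1%E)); last exact: cvg_cst.
(* From [n = 6] on, windows fit into the torus without wrapping onto themselves. *)
- exists 6%N => // n /= n6.
  have n2 : (2 < n)%N by exact: leq_trans n6.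
  apply/andP; split; last first.
    apply: probability_le1.
    exact: (measurable_always (hC _ n2) (fun c => p ^+ 13 < density c)).
  have := hC _ n2; case: n n6 n2 => [|[|[|m]]] // m6 _ hCm.
  have m3 : (3 <= m)%N by [].
  pose G (c : config (torus m.+3)) := p ^+ 13 * #|torus m.+3|%:R <
    \sum_(v : torus m.+3) (survivor v c)%:R.
  apply: (@le_trans _ _ (1 - \sum_(c | ~~ G c) bernoulli_config p c)%:E).
    rewrite lee_fin lerD2l lerN2.
    apply: le_trans (bernoulli_few_survivors m3 hp0 hp1) _.
    (* [harmonic n] is the inverse of [n + 1], and [n + 1 <= n ^ 2] here. *)
    rewrite ler_wpM2l // lef_pV2 ?posrE ?exprn_gt0 ?ltr0n // -natrX ler_nat.
    by rewrite expnS expn1; nia.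
  apply: (pd_process_always hCm (Q := fun c => p ^+ 13 < density c)) => c G0 steps t.
  have N0 : 0 < #|torus m.+3|%:R :> R by rewrite ltr0n card_prod card_ord.
  rewrite /G -(ltr_pdivlMr _ _ N0) in G0.
  apply: lt_le_trans G0 _; apply: density_ge_survivors => v.
  move=> /survivor_protected prot.
  suff : forall t, protected (@torus_adj _) (c t) (translate (2, 2)%N v).
    by move=> /(_ t) [].
  elim=> // s; apply: protected_step (steps s) => //.
  + exact: torus_adj_sym.
  + exact: torus_deg4.
- apply: cvg_EFin; first exact: nearW.
  rewrite -[X in _ --> X]subr0 -[X in _ - X](mulr0 K).
  by apply: cvgB; [exact: cvg_cst|apply: cvgMl_tmp; exact: cvg_harmonic].
Qed.
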